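(* Let $n\ge d\ge2$ be integers. For any unit vectors $v_1,\dots,v_n\in\mathbb C^d$ there exists a unit vector $q\in S^{2d-1}\subset\mathbb C^d$ such that its Euclidean distance to each of the $v_i$ is at least $\sqrt{\frac{d-1}{n}}$.
   Context: $S^{2d-1}$ is the unit sphere of $\mathbb C^d$ with its standard Hermitian norm. *)

(* Defs.v *)
From mathcomp Require Import all_boot all_order all_algebra.
From mathcomp Require Import reals complex.

Set Implicit Arguments.
Unset Strict Implicit.
Unset Printing Implicit Defensive.

Import Order.TTheory GRing.Theory Num.Theory.
Local Open Scope ring_scope.
Local Open Scope complex_scope.

(* [dotmx u v] is the sum of the u_j * conj v_j, so [dotmx v v] is real and
   nonnegative: [Re] only serves to land in R. *)
Definition hermnorm (R : realType) (d : nat) (v : 'rV[R[i]]_d) : R :=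
  Num.sqrt (complex.Re (dotmx v v)).

Definition hermdist (R : realType) (d : nat) (u v : 'rV[R[i]]_d) : R :=
  hermnorm (u - v).

Definition unit_sphere (R : realType) (d : nat) (v : 'rV[R[i]]_d) : Prop :=
  hermnorm v = 1.

(* Main.v *)
(** If the open balls of radius [sqrt r] around the [n] points cover the unit
    sphere, then any [n + 1] points of the sphere contain two in the same ball,
    hence at squared distance less than [4 r].  With [r = (d - 1) / n], it is
    therefore enough to find more than [n] points of the real unit sphere in
    dimension [N = 2 d] with pairwise squared distances at least
    [4 (d - 1) / n].  The configuration depends on [n]:
    - [n < N]: no packing, take a unit vector orthogonal to all the points;
    - [N <= n < 2 N]: the vectors [e_i] and [- e_i];
    - [2 N <= n < N (N - 1)]: the normalised roots [e_i - e_j];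
    - [N (N - 1) <= n < 2 ^ N]: the normalised vectors of signs;
    - [2 ^ N <= n]: a cubic grid with [(k + 1) ^ (N - 1)] points in the ball of
      dimension [N - 1], lifted to the sphere by the last coordinate, which can
      only increase distances. *)

Require Import Defs.
From mathcomp Require Import all_boot all_order all_algebra.
From mathcomp Require Import reals complex.
From mathcomp Require Import ring lra zify.

Set Implicit Arguments.
Unset Strict Implicit.
Unset Printing Implicit Defensive.

Import Order.TTheory GRing.Theory Num.Theory.
Local Open Scope ring_scope.
Local Open Scope complex_scope.

(** * Reduction to packings *)

Lemma escape_of_packing (R : realFieldType) (N n : nat) (T : finType)
    (f : T -> 'I_N -> R) (v : 'I_n -> 'I_N -> R) (r : R) :
  (n < #|T|)%N ->
  (forall a b, a != b -> 4 * r <= \sum_j (f a j - f b j) ^+ 2) ->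
  exists t, forall i, r <= \sum_j (f t j - v i j) ^+ 2.
Proof.
move=> ltnT sep.
case: (boolP [exists t, [forall i, r <= \sum_j (f t j - v i j) ^+ 2]]).
  by case/existsP=> t /forallP ?; exists t.
rewrite negb_exists => /forallP covered.
have close t : {i | \sum_j (f t j - v i j) ^+ 2 < r}.
  apply: sigW; move: (covered t); rewrite negb_forall => /existsP[k].
  by rewrite -ltNge; exists k.
suff /leq_card : injective (fun t => sval (close t)) by rewrite card_ord leqNgt ltnT.
move=> a b /=; case: (close a) (close b) => i ai [k bk] /= eq_ik; subst k.
apply/eqP/negPn/negP => /sep; apply/negP; rewrite -ltNge.
(* By the parallelogram law, two points sharing a centre are at squared distance at most twice the
   sum of their squared distances to it, so less than 4 r. *)
have /le_lt_trans-> // : \sum_j (f a j - f b j) ^+ 2 <=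
    2 * \sum_j (f a j - v i j) ^+ 2 + 2 * \sum_j (f b j - v i j) ^+ 2.
  rewrite !mulr_sumr -big_split; apply: ler_sum => j _ /=.
  by have := sqr_ge0 ((f a j - v i j) + (f b j - v i j)); lra.
by lra.
Qed.

(** Lets configurations keep integer or other unnormalised coordinates: only here are they divided
    by their common norm [Num.sqrt M]. *)
Lemma escape_of_scaled_packing (R : rcfType) (N n : nat) (T : finType)
    (f : T -> 'I_N -> R) (v : 'I_n -> 'I_N -> R) (r M D : R) :
  (n < #|T|)%N -> 0 < M -> 4 * r * M <= D ->
  (forall a, \sum_j f a j ^+ 2 = M) ->
  (forall a b, a != b -> D <= \sum_j (f a j - f b j) ^+ 2) ->
  exists q : 'I_N -> R, \sum_j q j ^+ 2 = 1 /\
    forall i, r <= \sum_j (q j - v i j) ^+ 2.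
Proof.
move=> ltnT M_gt0 leD fM sep.
have sM : (Num.sqrt M)^-1 ^+ 2 = M^-1 by rewrite exprVn sqr_sqrtr ?ltW.
have [|t ht] := @escape_of_packing R N n T (fun t j => f t j / Num.sqrt M) v r ltnT.
  move=> a b /sep leDs.
  under eq_bigr do rewrite -mulrBl exprMn sM.
  by rewrite -mulr_suml ler_pdivlMr // (le_trans leD).
exists (fun j => f t j / Num.sqrt M); split=> //.
under eq_bigr do rewrite exprMn sM.
by rewrite -mulr_suml fM divff ?gt_eqF.
Qed.

(** * Constructions for the ranges of [n] *)

Lemma sum_delta (R : realFieldType) (N : nat) (i k : 'I_N) :
  \sum_j ((j == i)%:R * (j == k)%:R) = (i == k)%:R :> R.
Proof.
rewrite (bigD1 i) //= eqxx mul1r big1 ?addr0 // => j /negPf->.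
by rewrite mul0r.
Qed.

Lemma sum_sqrB (R : realFieldType) (N : nat) (x y : 'I_N -> R) :
  \sum_j (x j - y j) ^+ 2 =
  \sum_j x j ^+ 2 + \sum_j y j ^+ 2 - 2 * \sum_j x j * y j.
Proof.
rewrite mulr_sumr -sumrN -!big_split; apply: eq_bigr => j _ /=.
by ring.
Qed.

Lemma escape_cross_polytope (R : rcfType) (N n : nat) (v : 'I_n -> 'I_N -> R) (r : R) :
  (n < N.*2)%N -> 2 * r <= 1 ->
  exists q : 'I_N -> R, \sum_j q j ^+ 2 = 1 /\
    forall i, r <= \sum_j (q j - v i j) ^+ 2.
Proof.
move=> ltnN r_le.
pose f (a : bool * 'I_N) j : R := (-1) ^+ a.1 * (j == a.2)%:R.
have dot a b : \sum_j f a j * f b j = (-1) ^+ a.1 * (-1) ^+ b.1 * (a.2 == b.2)%:R.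
  by rewrite -sum_delta mulr_sumr; apply: eq_bigr => j _; rewrite /f; ring.
have nrm a : \sum_j f a j ^+ 2 = 1.
  under eq_bigr do rewrite expr2.
  by rewrite dot eqxx mulr1 -expr2 sqrr_sign.
apply: (@escape_of_scaled_packing R N n _ f v r 1 2) => //; [|lra|].
  by rewrite card_prod card_bool card_ord mul2n.
move=> a b nab; rewrite sum_sqrB !nrm dot.
case: a b nab => [[] i] [[] j]; rewrite xpair_eqE /= => nab;
  case: eqP nab => //= _ _; rewrite ?expr0 ?expr1; lra.
Qed.

Lemma escape_roots (R : rcfType) (N n : nat) (v : 'I_n -> 'I_N -> R) (r : R) :
  (n < N * N.-1)%N -> 4 * r <= 1 ->
  exists q : 'I_N -> R, \sum_j q j ^+ 2 = 1 /\
    forall i, r <= \sum_j (q j - v i j) ^+ 2.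
Proof.
move=> ltnN r_le.
(* [lift a.1 a.2] runs over the indices other than [a.1], so each root is indexed once. *)
pose f (a : 'I_N * 'I_N.-1) j : R := (j == a.1)%:R - (j == lift a.1 a.2)%:R.
have dot a b : \sum_j f a j * f b j = (a.1 == b.1)%:R - (a.1 == lift b.1 b.2)%:R
    - (lift a.1 a.2 == b.1)%:R + (lift a.1 a.2 == lift b.1 b.2)%:R.
  rewrite -!sum_delta -!sumrN -!big_split; apply: eq_bigr => j _ /=.
  by rewrite /f; ring.
have nrm a : \sum_j f a j ^+ 2 = 2.
  under eq_bigr do rewrite expr2.
  by rewrite dot !eqxx (negPf (neq_lift _ _)) eq_sym (negPf (neq_lift _ _)) /=; ring.
apply: (@escape_of_scaled_packing R N n _ f v r 2 2) => //; [|lra|].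
  by rewrite card_prod !card_ord.
move=> a b nab; rewrite sum_sqrB !nrm dot.
(* Unless both indices agree, the inner product is at most 1, so the squared distance is at least 2
   + 2 - 2 = 2. *)
have : ~~ ((a.1 == b.1) && (lift a.1 a.2 == lift b.1 b.2)).
  apply: contra nab; case: a b => [i k] [i' k'] /= /andP[/eqP <-].
  by move=> /eqP /lift_inj ->.
do 4 case: eqP => _ //=; lra.
Qed.

Lemma escape_hypercube (R : rcfType) (N n : nat) (v : 'I_n -> 'I_N -> R) (r : R) :
  (0 < N)%N -> (n < 2 ^ N)%N -> r * N%:R <= 1 ->
  exists q : 'I_N -> R, \sum_j q j ^+ 2 = 1 /\
    forall i, r <= \sum_j (q j - v i j) ^+ 2.
Proof.
move=> N_gt0 ltnN r_le.
pose f (a : {ffun 'I_N -> bool}) j : R := (-1) ^+ (a j).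
apply: (@escape_of_scaled_packing R N n _ f v r N%:R 4) => //.
- by rewrite card_ffun card_bool card_ord.
- by rewrite ltr0n.
- lra.
- move=> a; under eq_bigr do rewrite sqrr_sign.
  by rewrite sumr_const card_ord.
(* By contraposition: a coordinate where the signs differ contributes 2 ^ 2 = 4 by itself. *)
move=> a b; apply: contraR => lt4; apply/eqP/ffunP => j.
move: lt4; rewrite -ltNge (bigD1 j) //= => lt4.
have rest_ge0 : 0 <= \sum_(i | i != j) (f a i - f b i) ^+ 2.
  by apply: sumr_ge0 => i _; apply: sqr_ge0.
have : (f a j - f b j) ^+ 2 < 4 by lra.
by rewrite /f; case: (a j); case: (b j) => //=; rewrite ?expr0 ?expr1; lra.
Qed.

Lemma eq_of_close_doubles (R : realFieldType) (p q : nat) (c : R) :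
  ((2 * p%:R - c) - (2 * q%:R - c)) ^+ 2 < 4 -> p = q.
Proof.
move=> lt4; have : `|p%:Z - q%:Z| < 1.
  rewrite -(ltr_int R) intr_norm intrB -!pmulrn.
  by rewrite -(ltr_pXn2r (n:=2)) ?nnegrE // real_normK ?num_real //; lra.
by rewrite ltr_norml => /andP[]; lia.
Qed.

(* The grid coordinates [2 a - k], [0 <= a <= k], are 2 apart and at most [k] in
   absolute value, so [m] of them leave room for a coordinate that completes the
   squared norm to [m k ^ 2]. *)
Lemma escape_lifted_grid (R : rcfType) (m k n : nat) (v : 'I_n -> 'I_m.+1 -> R) (r : R) :
  (0 < m)%N -> (0 < k)%N -> (n < k.+1 ^ m)%N -> r * (m * k ^ 2)%:R <= 1 ->
  exists q : 'I_m.+1 -> R, \sum_j q j ^+ 2 = 1 /\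
    forall i, r <= \sum_j (q j - v i j) ^+ 2.
Proof.
move=> m_gt0 k_gt0 ltnk r_le.
pose x (a : {ffun 'I_m -> 'I_k.+1}) j : R := 2 * (a j)%:R - k%:R.
pose f a (j : 'I_m.+1) : R := if unlift ord0 j is Some j' then x a j'
  else Num.sqrt ((m * k ^ 2)%:R - \sum_j x a j ^+ 2).
have f0 a : f a ord0 = Num.sqrt ((m * k ^ 2)%:R - \sum_j x a j ^+ 2).
  by rewrite /f unlift_none.
have fS a j : f a (lift ord0 j) = x a j by rewrite /f liftK.
have x_le a j : x a j ^+ 2 <= k%:R ^+ 2.
  rewrite /x; have : (a j)%:R <= k%:R :> R by rewrite ler_nat -ltnS.
  have : 0 <= (a j)%:R :> R by [].
  by nra.
apply: (@escape_of_scaled_packing R _ n _ f v r (m * k ^ 2)%:R 4) => //.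
- by rewrite card_ffun !card_ord.
- by rewrite ltr0n muln_gt0 m_gt0 expn_gt0 k_gt0.
- lra.
- move=> a; rewrite big_ord_recl f0; under [X in _ + X]eq_bigr do rewrite fS.
  rewrite sqr_sqrtr ?subrK // subr_ge0.
  apply: le_trans (ler_sum _ (fun j _ => x_le a j)) _.
  by rewrite sumr_const card_ord natrM natrX mulr_natl.
move=> a b; apply: contraR => lt4; apply/eqP/ffunP => j.
move: lt4; rewrite -ltNge (bigD1 (lift ord0 j)) //= => lt4.
have rest_ge0 : 0 <= \sum_(i | i != lift ord0 j) (f a i - f b i) ^+ 2.
  by apply: sumr_ge0 => i _; apply: sqr_ge0.
have : (f a (lift ord0 j) - f b (lift ord0 j)) ^+ 2 < 4 by lra.
by rewrite !fS => /eq_of_close_doubles; apply: val_inj.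
Qed.

(** By Pythagoras, a unit vector orthogonal to [v i] is at squared distance 1 + |v i| ^ 2 >= 1 from
    it. *)
Lemma escape_orthogonal (R : rcfType) (N n : nat) (v : 'I_n -> 'I_N -> R) (r : R) :
  (n < N)%N -> r <= 1 ->
  exists q : 'I_N -> R, \sum_j q j ^+ 2 = 1 /\
    forall i, r <= \sum_j (q j - v i j) ^+ 2.
Proof.
move=> ltnN r_le; pose A := (\matrix_(j, i) v i j : 'M[R]_(N, n)).
have : kermx A != 0.
  by rewrite -mxrank_eq0 mxrank_ker subn_eq0 -ltnNge (leq_ltn_trans (rank_leq_col _)).
rewrite -nz_row_eq0.
have /sub_kermxP : (nz_row (kermx A) <= kermx A)%MS by apply: nz_row_sub.
move: (nz_row _) => u uA0 u_neq0.
have uA i : \sum_j u 0 j * v i j = 0.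
  have /matrixP /(_ 0 i) := uA0; rewrite !mxE => uAi.
  by rewrite -[RHS]uAi; apply: eq_bigr => j _; rewrite mxE.
pose s := \sum_j u 0 j ^+ 2.
have s_gt0 : 0 < s.
  have [j uj] := rV0Pn _ u_neq0.
  rewrite /s (bigD1 j) //= ltr_pwDl ?exprn_even_gt0 //.
  by apply: sumr_ge0 => k _; apply: sqr_ge0.
have qs : \sum_j (u 0 j / Num.sqrt s) ^+ 2 = 1.
  under eq_bigr do rewrite exprMn exprVn sqr_sqrtr ?ltW //.
  by rewrite -mulr_suml divff ?gt_eqF.
exists (fun j => u 0 j / Num.sqrt s); split=> // i.
rewrite sum_sqrB qs.
under [X in _ - 2 * X]eq_bigr do rewrite mulrAC.
rewrite -mulr_suml uA mul0r mulr0 subr0 (le_trans r_le) // lerDl.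
by apply: sumr_ge0 => k _; apply: sqr_ge0.
Qed.

(* With [d = e + 2] and [m = 2 d - 1]: [k] is the largest integer with
   [k ^ m <= n]; the middle inequality is [(d - 1) m k ^ 2 <= n]. *)
Lemma grid_size (e n : nat) (m := (2 * e + 3)%N) : (4 ^ e.+2 <= n)%N ->
  exists k, [&& (0 < k)%N, (e.+1 * (m * k ^ 2) <= n)%N & (n < k.+1 ^ m)%N].
Proof.
move=> len.
have exk : exists k, (n < k.+1 ^ m)%N.
  exists n; rewrite -[X in (X < _)%N]expn1.
  apply: (@leq_trans (n.+1 ^ 1)); first by rewrite !expn1.
  by rewrite leq_exp2l /m; lia.
case: (ex_minnP exk) => k ltn kmin; exists k; rewrite ltn andbT.
have k_ge2 : (2 <= k)%N.
  (* If k <= 1, then n < 2 ^ m <= 4 ^ (e + 2), since m < 2 (e + 2). *)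
  rewrite ltnNge; apply/negP => k_le1.
  suff : (k.+1 ^ m <= 4 ^ e.+2)%N by lia.
  apply: (@leq_trans (2 ^ m)); first by rewrite leq_exp2r /m; lia.
  by rewrite (_ : 4 = 2 ^ 2)%N // -expnM leq_exp2l /m; lia.
have le_kn : (k ^ m <= n)%N.
  case: k k_ge2 {ltn} kmin => // k _ kmin.
  by rewrite leqNgt; apply/negP => /kmin; rewrite ltnn.
apply/andP; split; first by lia.
(* For k >= 3, cancelling k ^ 2 leaves (e + 1) m <= 3 ^ (m - 2). The analogue with base 2 fails for
   e = 0 and e = 1, so k = 2 relies on n >= 4 ^ (e + 2) instead. *)
case: (ltnP 2 k) => [k_gt2|k_le2].
  apply: leq_trans le_kn; rewrite mulnA.
  have -> : m = (2 * e + 1 + 2)%N by rewrite /m; lia.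
  rewrite expnD leq_pmul2r ?expn_gt0 ?(ltnW (ltnW k_gt2)) //.
  apply: (@leq_trans (3 ^ (2 * e + 1))); last by rewrite leq_exp2r; lia.
  elim: (e) => // f IHf.
  rewrite (_ : 2 * f.+1 + 1 = (2 * f + 1).+2)%N; last by lia.
  rewrite !expnS; lia.
have -> : k = 2 by lia.
apply: leq_trans len; rewrite /m.
elim: (e) => // f IHf; rewrite [(4 ^ _.+3)%N]expnS; lia.
Qed.

Lemma real_sphere_escape (R : rcfType) (d n : nat)
    (v : 'I_n -> 'I_(d + d) -> R) (r := (d%:R - 1) / n%:R : R) :
  (2 <= d)%N -> (d <= n)%N ->
  exists q : 'I_(d + d) -> R, \sum_j q j ^+ 2 = 1 /\
    forall i, r <= \sum_j (q j - v i j) ^+ 2.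
Proof.
case: d v @r => [|[|e]] // v r _ le_dn.
(* Every range of [n] needs just r c <= 1, with c = 1, 2, 4, N or m k ^ 2 in turn; as r = (e + 1) /
   n, this becomes an inequality in [nat]. *)
have r_le (c : nat) : (e.+1 * c <= n)%N -> r * c%:R <= 1.
  move=> le_cn; rewrite /r mulrSr addrK mulrAC ler_pdivrMr ?ltr0n; last by lia.
  by rewrite mul1r -natrM ler_nat.
move: r r_le v => r r_le.
rewrite (_ : e.+2 + e.+2 = (2 * e + 3).+1)%N => [v|]; last by lia.
have [lt1|ge1] := ltnP n (2 * e + 3).+1.
  by apply: escape_orthogonal => //; have := @r_le 1; rewrite mulr1; apply; lia.
have [lt2|ge2] := ltnP n (2 * e + 3).+1.*2.
  by apply: escape_cross_polytope => //; rewrite mulrC; apply: r_le; lia.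
have [lt3|ge3] := ltnP n ((2 * e + 3).+1 * (2 * e + 3)).
  by apply: escape_roots => //; rewrite mulrC; apply: r_le; lia.
have [lt4|ge4] := ltnP n (4 ^ e.+2).
  apply: escape_hypercube; [by lia | | by apply: r_le; nia].
  by rewrite (_ : (2 * e + 3).+1 = 2 * e.+2)%N ?expnM //; lia.
have [k /and3P[k_gt0 le_kn lt_nk]] := grid_size ge4.
by apply: (escape_lifted_grid (k := k)) => //; [lia | apply: r_le].
Qed.

(** * From real to complex coordinates *)

Lemma Re_dotmx (R : rcfType) (d : nat) (u : 'rV[R[i]]_d) :
  complex.Re (dotmx u u) =
  \sum_j complex.Re (u 0 j) ^+ 2 + \sum_j complex.Im (u 0 j) ^+ 2.
Proof.
rewrite dotmxE mxE (raddf_sum (@complex.Re R : Rcomplex R -> R)) -big_split.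
by apply: eq_bigr => j _; rewrite !mxE; case: (u 0 j) => a b /=; ring.
Qed.

Theorem corollary1p9 (R : realType) (n d : nat) (hd : (2 <= d)%N)
    (hdn : (d <= n)%N) (v : 'I_n -> 'rV[R[i]]_d)
    (hv : forall i : 'I_n, unit_sphere (v i)) :
  exists q : 'rV[R[i]]_d,
    unit_sphere q /\
    forall i : 'I_n, Num.sqrt ((d%:R - 1) / n%:R) <= hermdist q (v i).
Proof.
(* C^d is read as R^(2 d): first all real parts, then all imaginary parts. *)
pose w k (j : 'I_(d + d)) := match split j with
  | inl a => complex.Re (v k 0 a) | inr a => complex.Im (v k 0 a) end.
have wl k a : w k (lshift d a) = complex.Re (v k 0 a).
  by rewrite /w (unsplitK (inl a)).
have wr k a : w k (rshift d a) = complex.Im (v k 0 a).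
  by rewrite /w (unsplitK (inr a)).
have [q [q1 q_far]] := real_sphere_escape w hd hdn.
exists (\row_j (q (lshift d j) +i* q (rshift d j))); split=> [|k].
  rewrite /unit_sphere /hermnorm Re_dotmx -[RHS]sqrtr1 -q1 big_split_ord.
  by congr (Num.sqrt (_ + _)); apply: eq_bigr => j _; rewrite mxE.
rewrite /hermdist /hermnorm ler_wsqrtr // Re_dotmx.
apply: le_trans (q_far k) _; rewrite big_split_ord.
apply: lerD; apply: ler_sum => j _; rewrite !mxE ?wl ?wr;
  by case: (v k 0 j).
Qed.
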